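(* Let $k>3$ be an integer. Then the equation $x^{2}-(k^{2}-4)y^{2}=-4$ has no positive integer solutions $(x,y)$.
   Context: A positive integer solution is a pair $(x,y)$ of positive integers satisfying the equation. *)

(* Defs.v *)
(* Stdlib world: binary integers Z. *)
From Stdlib Require Export ZArith.

(* Main.v *)
Require Import Defs.
From Stdlib Require Import ZArith.
From Stdlib Require Import Lia.

(** Writing [x = k y - 2 z], which is possible because [x] and [k y] have the
    same parity, turns the equation into the symmetric form
    [y^2 + z^2 + 1 = k y z], again with [y] and [z] positive.  That equation is
    handled by Vieta jumping: as a quadratic in its larger unknown [a], it has
    the second root [k b - a = (b^2 + 1) / a], which yields a smaller positive
    solution.  The descent could only stop at a solution with [a = b], and then
    [(k - 2) a^2 = 1], which forces [k = 3]. *)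

Local Open Scope Z_scope.

(** The descent is on the larger unknown: the jump replaces [(a, b)] by
    [(b, k b - a)], which is again ordered because [b < a] gives
    [a (k b - a) = b^2 + 1 < (b + 1)^2]. *)
Lemma vieta_no_ordered_solution (k : Z) (hk : 3 < k) (a : Z) :
  0 <= a -> forall b : Z, 0 < b <= a -> a ^ 2 + b ^ 2 + 1 <> k * a * b.
Proof.
  intros Ha; pattern a; apply Z_lt_induction; [clear a Ha | exact Ha].
  intros a IH b [Hb Hba] Heq.
  assert (Hlt : b < a).
  { destruct (Z.eq_dec a b) as [-> | Hne]; [exfalso; nia | lia]. }
  assert (Hvieta : a * (k * b - a) = b ^ 2 + 1) by lia.
  assert (Hpos : 0 < k * b - a) by nia.
  assert (Hle : k * b - a <= b) by nia.
  apply (IH b ltac:(lia) (k * b - a)); [lia | nia].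
Qed.

Lemma vieta_no_positive_solution (k : Z) (hk : 3 < k) (a b : Z) :
  0 < a -> 0 < b -> a ^ 2 + b ^ 2 + 1 <> k * a * b.
Proof.
  intros Ha Hb Heq.
  destruct (Z.le_ge_cases b a) as [Hle | Hle].
  - apply (vieta_no_ordered_solution k hk a ltac:(lia) b); lia.
  - apply (vieta_no_ordered_solution k hk b ltac:(lia) a); lia.
Qed.

(** The equation says that [(k y)^2 - x^2] is a multiple of 4. *)
Lemma pell_same_parity (k x y : Z) :
  x ^ 2 - (k ^ 2 - 4) * y ^ 2 = -4 -> exists z : Z, k * y - x = 2 * z.
Proof.
  intros Heq.
  destruct (Z.Even_or_Odd (k * y - x)) as [[z Hz] | [z Hz]].
  - now exists z.
  - exfalso.
    assert (Hx : x = k * y - 2 * z - 1) by lia.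
    subst x; nia.
Qed.

Theorem theorem18 (k : Z) (hk : 3 < k) :
  ~ (exists x y : Z, 0 < x /\ 0 < y /\ x ^ 2 - (k ^ 2 - 4) * y ^ 2 = -4).
Proof.
  intros [x [y [Hx [Hy Heq]]]].
  destruct (pell_same_parity k x y Heq) as [z Hz].
  (* [z] is positive because [x^2 = (k y)^2 - 4 (y^2 + 1) < (k y)^2]. *)
  assert (Hxk : x < k * y) by nia.
  apply (vieta_no_positive_solution k hk y z); [lia | lia |].
  assert (Hsub : x = k * y - 2 * z) by lia.
  subst x; lia.
Qed.
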